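(* The following conditions are equivalent: (i) $IP_{A,c}$ is a Gomory family. (ii) The associated sets of $IP_{A,c}$ are precisely the maximal faces of $\Delta_c$. (iii) $(\ast,\tau)$ is a standard pair of $\mathcal{O}_c$ if and only if $\tau$ is a maximal face of $\Delta_c$. (iv) All standard polytopes of $IP_{A,c}$ are simplices.
   Context: $\mathbb{N}$ denotes the non-negative integers. $A \in \mathbb{Z}^{d\times n}$ is a fixed matrix of rank $d$ with columns $a_1,\dots,a_n$; $\mathrm{cone}(A)=\{Au : u\in\mathbb{R}^n, u\ge 0\}$ is pointed and $\{u\in\mathbb{R}^n: Au=0, u\ge 0\}=\{0\}$; $\mathbb{N}A=\{Au: u\in\mathbb{N}^n\}$. For $b\in\mathbb{N}A$, $IP_{A,c}(b)$ is the program $\min\{c\cdot x: Ax=b, x\in\mathbb{N}^n\}$; $IP_{A,c}$ is the family of these programs. The cost vector $c\in\mathbb{Z}^n$ is generic, i.e. each $IP_{A,c}(b)$, $b\in\mathbb{N}A$, has a unique optimal solution. $\mathcal{O}_c\subset\mathbb{N}^n$ is the set of all optimal solutions of all programs in $IP_{A,c}$. For $\sigma\subseteq\{1,\dots,n\}$, $\bar\sigma$ is the complement, $A_\sigma$ the submatrix of columns indexed by $\sigma$, $x_\sigma$ the subvector indexed by $\sigma$. The regular triangulation $\Delta_c$ is the set of all $\sigma\subseteq\{1,\dots,n\}$ for which there is $y\in\mathbb{R}^d$ with $y\cdot a_j=c_j$ for $j\in\sigma$ and $y\cdot a_j<c_j$ for $j\notin\sigma$; its elements are called faces (by genericity, they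 label a complex of simplicial cones $\mathrm{cone}(A_\sigma)$ with support $\mathrm{cone}(A)$, whose maximal faces have $d$ elements). Group relaxation: for $\tau\in\Delta_c$ and $b\in\mathbb{N}A$, $G^\tau(b)$ is the program $\min\{\tilde c_{\bar\tau}\cdot x_{\bar\tau}: A_\tau x_\tau+A_{\bar\tau}x_{\bar\tau}=b,\ x_{\bar\tau}\ge 0,\ (x_\tau,x_{\bar\tau})\in\mathbb{Z}^n\}$, where $\tilde c_{\bar\tau}$ consists of the coordinates indexed by $\bar\tau$ of $c-c_\sigma A_\sigma^{-1}A$ for any maximal face $\sigma\supseteq\tau$ of $\Delta_c$. $G^\tau(b)$ solves $IP_{A,c}(b)$ if its optimal solution $(x_\tau^*,x_{\bar\tau}^* )\in\mathbb{Z}^n$ is non-negative (equivalently, equals the optimal solution of $IP_{A,c}(b)$). Gomory family: $IP_{A,c}$ is a Gomory family if for every $b\in\mathbb{N}A$, $IP_{A,c}(b)$ is solved by a group relaxation $G^\sigma(b)$ where $\sigma$ is a maximal face of $\Delta_c$. Associated set of $IP_{A,c}$: a face $\tau\in\Delta_c$ such that for some $b\in\mathbb{N}A$, $G^\tau(b)$ solves $IP_{A,c}(b)$ but $G^{\tau'}(b)$ does not, for all faces $\tau'\in\Delta_c$ with $\tau\subsetneq\tau'$. For $u\in\mathbb{N}^n$ and $\tau\in\Delta_c$, $S(u,\tau)=u+\mathbb{N}(e_i: i\in\tau)$, with $e_i$ the unit vectors of $\mathbb{R}^n$; $\mathrm{supp}(u)=\{i: u_i\ne 0\}$. For $\tau\in\Delta_c$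 and $u\in\mathcal{O}_c$, $(u,\tau)$ is an admissible pair of $\mathcal{O}_c$ if $\mathrm{supp}(u)\subseteq\bar\tau$ and $S(u,\tau)\subseteq\mathcal{O}_c$. An admissible pair $(u,\tau)$ is a standard pair of $\mathcal{O}_c$ if $S(u,\tau)$ is not properly contained in $S(v,\tau')$ for another admissible pair $(v,\tau')$ of $\mathcal{O}_c$. The notation $(\ast,\tau)$ stands for a pair with second entry $\tau$ and unspecified first entry, so ''$(\ast,\tau)$ is a standard pair'' means that there is a standard pair with second entry $\tau$. Let $B\in\mathbb{Z}^{n\times(n-d)}$ be a matrix whose columns generate the lattice $\{x\in\mathbb{Z}^n: Ax=0\}$, let $B^{\bar\tau}$ be obtained from $B$ by deleting the rows indexed by $\tau$, and let $\pi_\tau(u)$ be $u$ with the coordinates indexed by $\tau$ deleted. For $u\in\mathbb{N}^n$ and $\tau\in\Delta_c$, the polytope $Q_u^{\bar\tau}=\{z\in\mathbb{R}^{n-d}: B^{\bar\tau}z\le\pi_\tau(u),\ (-cB)\cdot z\le 0\}$ is a standard polytope of $IP_{A,c}$ if $Q_u^{\bar\tau}\cap\mathbb{Z}^{n-d}=\{0\}$ and every relaxation of $Q_u^{\bar\tau}$ obtained by removing an inequality in $B^{\bar\tau}z\le\pi_\tau(u)$ contains a non-zero lattice point.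
   Formalization: In (iv), ''simplex'' means a simplex as a point set (a single point allowed) that is also given by exactly n-d+1 inequalities; for point sets alone (iv)⇒(i) fails, e.g. A=(3 4 5), c=(0,1,3). *)

(* Defs.v *)
From HB Require Import structures.
From mathcomp Require Import all_boot all_order all_algebra.
From mathcomp Require Import boolp classical_sets reals.

Set Implicit Arguments.
Unset Strict Implicit.
Unset Printing Implicit Defensive.

Import Order.TTheory GRing.Theory Num.Theory.

Local Open Scope classical_set_scope.
Local Open Scope ring_scope.

(* Vectors of N^n are represented by the nonnegative vectors of Z^n. *)
Definition nonneg (F : numDomainType) (n : nat) (x : 'cV[F]_n) : Prop :=
  forall i, 0 <= x i 0.

Definition to_real (R : realType) (m n : nat) (M : 'M[int]_(m, n)) : 'M[R]_(m, n) :=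
  map_mx intr M.

Definition minimizer (T : Type) (F : numDomainType) (S : set T) (f : T -> F)
    (x : T) : Prop :=
  S x /\ forall y, S y -> f x <= f y.

(* Restriction of a matrix to the columns, resp. the rows, indexed by s. *)
Definition cols (F : Type) (m n : nat) (s : {set 'I_n}) (M : 'M[F]_(m, n)) :
    'M[F]_(m, #|s|) :=
  colsub (fun k : 'I_#|s| => enum_val k) M.

Definition rows (F : Type) (m n : nat) (s : {set 'I_m}) (M : 'M[F]_(m, n)) :
    'M[F]_(#|s|, n) :=
  rowsub (fun k : 'I_#|s| => enum_val k) M.

Definition supp (n : nat) (u : 'cV[int]_n) : {set 'I_n} :=
  [set i | u i 0 != 0]%SET.

Definition cone (R : realType) (d n : nat) (A : 'M[int]_(d, n)) : set 'cV[R]_d :=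
  [set to_real R A *m u | u in @nonneg R n].
Arguments cone R {d n} A _.

Definition pointed (R : realType) (d : nat) (C : set 'cV[R]_d) : Prop :=
  forall v, C v -> C (- v) -> v = 0.

Definition semigroup (d n : nat) (A : 'M[int]_(d, n)) : set 'cV[int]_d :=
  [set A *m u | u in @nonneg int n].

Definition IP_feasible (d n : nat) (A : 'M[int]_(d, n)) (b : 'cV[int]_d) :
    set 'cV[int]_n :=
  [set x | A *m x = b /\ nonneg x].

Definition IP_optimal (d n : nat) (A : 'M[int]_(d, n)) (c : 'rV[int]_n)
    (b : 'cV[int]_d) (x : 'cV[int]_n) : Prop :=
  minimizer (IP_feasible A b) (fun x => (c *m x) 0 0) x.

Definition generic (d n : nat) (A : 'M[int]_(d, n)) (c : 'rV[int]_n) : Prop :=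
  forall b, semigroup A b -> exists! x, IP_optimal A c b x.

Definition optimal_set (d n : nat) (A : 'M[int]_(d, n)) (c : 'rV[int]_n) :
    set 'cV[int]_n :=
  [set x | exists2 b, semigroup A b & IP_optimal A c b x].

Definition face (R : realType) (d n : nat) (A : 'M[int]_(d, n)) (c : 'rV[int]_n)
    (s : {set 'I_n}) : Prop :=
  exists y : 'rV[R]_d,
    (forall j, j \in s -> (y *m to_real R A) 0 j = to_real R c 0 j) /\
    (forall j, j \notin s -> (y *m to_real R A) 0 j < to_real R c 0 j).

Definition maximal_face (R : realType) (d n : nat) (A : 'M[int]_(d, n))
    (c : 'rV[int]_n) (s : {set 'I_n}) : Prop :=
  face R A c s /\ forall s', face R A c s' -> s \subset s' -> s' = s.

(* c - c_s A_s^-1 A.  This is only used for a maximal face s: then #|s| = d and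
   A_s is invertible, so that pinvmx is its two-sided inverse (mulmxVp,
   mulVpmx); A_s has the type 'M_(d, #|s|), to which invmx does not apply. *)
Definition reduced_cost (R : realType) (d n : nat) (A : 'M[int]_(d, n))
    (c : 'rV[int]_n) (s : {set 'I_n}) : 'rV[R]_n :=
  to_real R c
  - cols s (to_real R c) *m pinvmx (cols s (to_real R A)) *m to_real R A.

Definition group_feasible (d n : nat) (A : 'M[int]_(d, n)) (t : {set 'I_n})
    (b : 'cV[int]_d) : set 'cV[int]_n :=
  [set x | A *m x = b /\ forall i, i \notin t -> 0 <= x i 0].

(* The group relaxation G^t(b), whose cost is computed from the maximal face s. *)
Definition group_optimal (R : realType) (d n : nat) (A : 'M[int]_(d, n))
    (c : 'rV[int]_n) (t s : {set 'I_n}) (b : 'cV[int]_d) (x : 'cV[int]_n) : Prop :=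
  minimizer (group_feasible A t b)
    (fun x => \sum_(i | i \notin t) reduced_cost R A c s 0 i * (x i 0)%:~R) x.

(* For a face t, the objectives obtained from two maximal faces s containing t
   differ by a constant on group_feasible A t b, so the choice of s is
   immaterial; for generic c and b in NA the optimal solution is unique. *)
Definition group_solves (R : realType) (d n : nat) (A : 'M[int]_(d, n))
    (c : 'rV[int]_n) (t : {set 'I_n}) (b : 'cV[int]_d) : Prop :=
  exists s, [/\ maximal_face R A c s, t \subset s &
    exists2 x, group_optimal R A c t s b x & nonneg x].

Definition gomory_family (R : realType) (d n : nat) (A : 'M[int]_(d, n))
    (c : 'rV[int]_n) : Prop :=
  forall b, semigroup A b ->
    exists2 s, maximal_face R A c s & group_solves R A c s b.

Definition associated_set (R : realType) (d n : nat) (A : 'M[int]_(d, n))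
    (c : 'rV[int]_n) (t : {set 'I_n}) : Prop :=
  face R A c t /\
  exists b, [/\ semigroup A b, group_solves R A c t b &
    forall t', face R A c t' -> t \proper t' -> ~ group_solves R A c t' b].

Definition translate (n : nat) (u : 'cV[int]_n) (t : {set 'I_n}) :
    set 'cV[int]_n :=
  [set x | exists k : 'I_n -> nat, x = u + \sum_(i in t) delta_mx i 0 *+ k i].

Definition admissible_pair (R : realType) (d n : nat) (A : 'M[int]_(d, n))
    (c : 'rV[int]_n) (u : 'cV[int]_n) (t : {set 'I_n}) : Prop :=
  [/\ face R A c t, optimal_set A c u, supp u \subset ~: t &
      translate u t `<=` optimal_set A c].

Definition standard_pair (R : realType) (d n : nat) (A : 'M[int]_(d, n))
    (c : 'rV[int]_n) (u : 'cV[int]_n) (t : {set 'I_n}) : Prop :=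
  admissible_pair R A c u t /\
  forall v t', admissible_pair R A c v t' -> ~ (translate u t `<` translate v t').

Definition lattice_basis (d n m : nat) (A : 'M[int]_(d, n)) (B : 'M[int]_(n, m)) :
    Prop :=
  forall x : 'cV[int]_n, A *m x = 0 <-> exists z : 'cV[int]_m, x = B *m z.

Definition hpolyhedron (R : realType) (k m : nat) (M : 'M[R]_(k, m)) (r : 'cV[R]_k) :
    set 'cV[R]_m :=
  [set z | forall i, (M *m z) i 0 <= r i 0].

Definition conv_hull (R : realType) (k m : nat) (v : 'I_k -> 'cV[R]_m) :
    set 'cV[R]_m :=
  [set z | exists w : 'I_k -> R,
    [/\ forall i, 0 <= w i, \sum_i w i = 1 & z = \sum_i w i *: v i]].

Definition affinely_independent (R : realType) (k m : nat) (v : 'I_k -> 'cV[R]_m) :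
    Prop :=
  forall w : 'I_k -> R,
    \sum_i w i = 0 -> \sum_i w i *: v i = 0 -> forall i, w i = 0.

Definition simplex (R : realType) (m : nat) (P : set 'cV[R]_m) : Prop :=
  exists k (v : 'I_k.+1 -> 'cV[R]_m), affinely_independent v /\ P = conv_hull v.

(* A polytope of R^m given by inequalities M z <= r is a simplex if it is a
   simplex as a set and is cut out by m + 1 inequalities, as simplices of R^m are
   (the simplex may degenerate to a point: {0} is a standard polytope for every
   maximal face).  The number of inequalities cannot be dropped: for
   A = (3 4 5) and c = (0 1 3), all standard polytopes are simplices as sets, but
   the one of u = e_3 and the empty face, a triangle with a redundant cost
   inequality, comes with four inequalities, and the family is not Gomory (the
   optimal solution of G^{1}(5) is (-1, 2, 0)). *)
Definition hsimplex (R : realType) (k m : nat) (M : 'M[R]_(k, m)) (r : 'cV[R]_k) :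
    Prop :=
  simplex (hpolyhedron M r) /\ k = m.+1.

(* The inequalities B^p z <= u_p, (- c B) z <= 0, where p is the set of the rows
   of B that are kept: p = ~: t for the polytope of the pair (u, t). *)
Definition Q_lhs (R : realType) (n m : nat) (B : 'M[int]_(n, m)) (c : 'rV[int]_n)
    (p : {set 'I_n}) : 'M[R]_(#|p| + 1, m) :=
  to_real R (col_mx (rows p B) (- (c *m B))).

Definition Q_rhs (R : realType) (n : nat) (u : 'cV[int]_n) (p : {set 'I_n}) :
    'cV[R]_(#|p| + 1) :=
  to_real R (col_mx (rows p u) 0).

Definition Q (R : realType) (n m : nat) (B : 'M[int]_(n, m)) (c : 'rV[int]_n)
    (u : 'cV[int]_n) (p : {set 'I_n}) : set 'cV[R]_m :=
  hpolyhedron (Q_lhs R B c p) (Q_rhs R u p).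
Arguments Q R {n m} B c u p _.

Definition lattice_points (R : realType) (m : nat) (P : set 'cV[R]_m) :
    set 'cV[int]_m :=
  [set z | P (to_real R z)].

Definition standard_polytope (R : realType) (d n m : nat) (A : 'M[int]_(d, n))
    (c : 'rV[int]_n) (B : 'M[int]_(n, m)) (u : 'cV[int]_n) (t : {set 'I_n}) : Prop :=
  [/\ face R A c t, nonneg u, lattice_points (Q R B c u (~: t)) = [set 0] &
      forall i, i \in ~: t ->
        exists2 z, z != 0 & lattice_points (Q R B c u (~: t :\ i)) z].

(* Main.v *)
Require Import Defs.
From mathcomp Require Import all_boot all_order all_algebra.
From mathcomp Require Import boolp classical_sets reals.
(* Repeated so that names such as subsetP refer to finite sets. *)
From mathcomp Require Import fintype finset.

(** Call an index set t, face or not, a relaxation of the vector u >= 0 if u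
    minimizes c.x among the integral x with A x = A u and x_i >= 0 for i outside
    t.  For such a u this is equivalent to: no y in the lattice ker A has c.y < 0
    and u + y nonnegative outside t.  The criterion depends only on the
    coordinates of u outside t and it becomes stronger when t grows.  All notions
    of the theorem are expressed by it:
    - if u is optimal, G^t(A u) solves IP(A u) iff t is a face and a relaxation
      of u (group_solvesP), because the reduced cost of x is c.x minus a
      constant;
    - S(u, t) consists of optimal solutions iff t is a relaxation of u
      (translate_optimalP), because adding large multiples of the e_i, i in t,
      has the same effect as dropping the constraints indexed by t;
    - with y = - B z, the lattice points z of Q_u correspond to the y in the
      lattice with u + y nonnegative outside t and c.y <= 0; so t is a relaxation of
      u iff 0 is the only one (nonzero_lattice_pointP), where genericity excludes
      the y <> 0 with c.y = 0 (relax_strict).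

    Call t tight for u if it is a relaxation of u that is maximal under
    inclusion.  By Farkas' lemma every relaxation is a face (relax_face), so it
    makes no difference whether maximality refers to faces or to index sets.
    Hence t is associated iff it is tight for some u (associated_setP), t occurs
    in a standard pair iff it is tight for some u (standard_pairP), and the
    standard polytopes are exactly those of the tight pairs (standard_polytopeP).
    A maximal face is tight for 0 (maximal_face_tight).  So (ii) and (iii) both
    say that every tight t is a maximal face.

    That this is the Gomory property (gomory_familyP) is clear in one direction,
    since every optimal u has a tight t.  In the other direction, let t be tight
    for u and add a large multiple of the indicator vector of t to u.  The sum is
    an optimal solution that has a maximal face s as a relaxation; if some i in t
    were outside s, the integral dependency between a_i and the columns of s would
    give a lattice vector that decreases the cost and whose only negative entry
    outside s is the one at i, where there is room for it.  So t is contained in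
    s, and t = s by tightness.

    For (iv), a face t is maximal iff it has d elements, that is, iff Q_u is
    cut out by n - d + 1 inequalities (hsimplex_facets); and for a maximal face,
    the slacks w = u - B z turn Q_u into { w >= 0, a.w <= a.u } with all weights
    a_i > 0, which is a simplex, possibly a point (maximal_face_hsimplex). *)

Set Implicit Arguments.
Unset Strict Implicit.
Unset Printing Implicit Defensive.

Import Order.TTheory GRing.Theory Num.Theory.

Local Open Scope ring_scope.

(** * Farkas' lemma *)

Lemma oppmx_entry (V : zmodType) (m n : nat) (M : 'M[V]_(m, n)) i j :
  (- M) i j = - M i j.
Proof. exact: mxE. Qed.

Lemma submx_entry (V : zmodType) (m n : nat) (M N : 'M[V]_(m, n)) i j :
  (M - N) i j = M i j - N i j.
Proof. by rewrite [LHS]mxE oppmx_entry. Qed.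

Lemma row_space_of_kernel (F : fieldType) (m n p : nat) (A : 'M[F]_(m, n))
    (b : 'M[F]_(p, n)) :
  (forall x : 'cV[F]_n, A *m x = 0 -> b *m x = 0) -> exists y, b = y *m A.
Proof.
move=> ker0; suff /submxP : (b <= A)%MS by [].
rewrite submxE; apply/eqP/matrixP => i j.
have /ker0 : A *m col j (cokermx A) = 0 by rewrite colE mulmxA mulmx_coker mul0mx.
by rewrite colE mulmxA -colE => /colP/(_ i); rewrite !mxE.
Qed.

(** Bartl's induction on the number of rows of G.  If the row g is really needed,
    some x1 in ker A with H x1 >= 0 satisfies g x1 = -1 and b x1 <= 0.  The map
    x |-> x + (g x) x1 lands in the hyperplane g = 0, so that pulling H and b back
    along it gives an instance with one row less, which is solved by induction. *)
Lemma farkas (F : realFieldType) (d n k : nat) (A : 'M[F]_(d, n))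
    (G : 'M[F]_(k, n)) (b : 'rV[F]_n) :
  (forall x : 'cV[F]_n, A *m x = 0 -> nonneg (G *m x) -> 0 <= (b *m x) 0 0) ->
  exists (y : 'rV[F]_d) (l : 'rV[F]_k), (forall i, 0 <= l 0 i) /\ b = y *m A + l *m G.
Proof.
elim: k G b => [|k IHk] G b nonnegP.
  have G0 x : nonneg (G *m x) by case.
  have [x Ax0|y ->] := @row_space_of_kernel _ _ _ _ A b.
    apply/matrixP => i j; rewrite !ord1 [RHS]mxE; apply/eqP.
    rewrite eq_le nonnegP // andbT -oppr_ge0.
    have := nonnegP (- x) _ (G0 _).
    have -> : (b *m - x) 0 0 = - (b *m x) 0 0 by rewrite mulmxN oppmx_entry.
    by apply; rewrite mulmxN Ax0 oppr0.
  by exists y, 0; split => [i|]; rewrite ?mxE ?mul0mx ?addr0.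
rewrite -[k.+1]/((1 + k)%N) in G nonnegP *.
rewrite -[G]vsubmxK in nonnegP *; move: (usubmx G) (dsubmx G) nonnegP => g H nonnegP.
have split_nonneg x : 0 <= (g *m x) 0 0 -> nonneg (H *m x) ->
    nonneg (col_mx g H *m x).
  move=> gx Hx i; rewrite mul_col_mx -(splitK i).
  by case: (split i) => j /=; rewrite ?col_mxEu ?col_mxEd ?ord1.
have [Hb|] := pselect (forall x, A *m x = 0 -> nonneg (H *m x) -> 0 <= (b *m x) 0 0).
  have [y [l [l_ge0 ->]]] := IHk H b Hb.
  exists y, (row_mx 0 l); split; last by rewrite mul_row_col mul0mx add0r.
  move=> i; rewrite -(splitK i).
  by case: (split i) => j /=; rewrite ?row_mxEl ?row_mxEr ?mxE.
move=> /existsNP[x0 /not_implyP[Ax0 /not_implyP[Hx0 /negP]]].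
rewrite -ltNge => bx0.
have gx0 : (g *m x0) 0 0 < 0.
  rewrite ltNge; apply/negP => gx0.
  by have := nonnegP x0 Ax0 (split_nonneg _ gx0 Hx0); rewrite leNgt bx0.
(* x0 violates the implication for H alone, hence must violate g x0 >= 0. *)
pose x1 := (- (g *m x0) 0 0)^-1 *: x0.
have gx1 : g *m x1 = (- 1)%:M.
  rewrite -scalemxAr {2}[g *m x0]mx11_scalar scale_scalar_mx.
  by rewrite invrN mulNr mulVf // lt_eqF.
have x1_ge0 : 0 <= (- (g *m x0) 0 0)^-1 by rewrite invr_ge0 oppr_ge0 ltW.
have Ax1 : A *m x1 = 0 by rewrite -scalemxAr Ax0 scaler0.
have Hx1 : nonneg (H *m x1) by move=> i; rewrite -scalemxAr mxE mulr_ge0.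
have bx1 : (b *m x1) 0 0 <= 0 by rewrite -scalemxAr mxE mulr_ge0_le0 // ltW.
have [x Ax Hx|y [l [l_ge0 eqb]]] := IHk (H + H *m x1 *m g) (b + b *m x1 *m g).
  have := nonnegP (x + x1 *m (g *m x)).
  rewrite !mulmxDr !mulmxA Ax Ax1 !mul0mx addr0 => /(_ erefl) bP.
  rewrite mulmxDl; apply: bP.
  have -> : col_mx g H *m x + col_mx g H *m x1 *m g *m x =
            col_mx 0 ((H + H *m x1 *m g) *m x).
    rewrite !mul_col_mx add_col_mx gx1 mul_scalar_mx scaleN1r mulNmx subrr.
    by rewrite mulmxDl.
  move=> i; rewrite -(splitK i).
  by case: (split i) => j /=; rewrite ?col_mxEu ?col_mxEd // mxE.
exists y, (row_mx (l *m (H *m x1) - b *m x1) l); split.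
  move=> i; rewrite -(splitK i).
  case: (split i) => j /=; rewrite ?row_mxEl ?row_mxEr // !ord1 !mxE.
  rewrite addr_ge0 ?oppr_ge0 //; last by move: bx1; rewrite mxE.
  by apply: sumr_ge0 => p _; rewrite mulr_ge0.
apply/(addIr (b *m x1 *m g)); rewrite eqb mul_row_col mulmxBl mulmxDr !mulmxA.
by rewrite -!addrA [X in _ + X]addrC; congr (_ + (_ + _)); rewrite addrCA addNr addr0.
Qed.

(** * Integral, rational and real matrices *)

Lemma clear_denominators (n : nat) (q : 'cV[rat]_n) :
  exists D (z : 'cV[int]_n), 0 < D /\ map_mx intr z = D%:~R *: q.
Proof.
pose D := \prod_i denq (q i 0).
exists D, (\col_i (numq (q i 0) * \prod_(j | j != i) denq (q j 0))); split.
  by apply: prodr_gt0 => i _; apply: denq_gt0.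
apply/colP => i; rewrite !mxE /D [X in _ = X%:~R * _](bigD1 i) //= !intrM mulrAC.
by congr (_ * _); rewrite mulrC numqE.
Qed.

Section RealImage.
Variable R : realType.

Lemma to_real_mul (m n p : nat) (M : 'M[int]_(m, n)) (N : 'M[int]_(n, p)) :
  to_real R (M *m N) = to_real R M *m to_real R N.
Proof. exact: map_mxM. Qed.

Lemma to_realE (m n : nat) (M : 'M[int]_(m, n)) :
  to_real R M = map_mx ratr (map_mx intr M).
Proof. by apply/matrixP => i j; rewrite !mxE ratr_int. Qed.

Lemma to_real_inj (m n : nat) : injective (@to_real R m n).
Proof. by move=> M N /matrixP e; apply/matrixP => i j; have := e i j; rewrite !mxE => /intr_inj. Qed.

Lemma rank_to_real (m n : nat) (M : 'M[int]_(m, n)) :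
  \rank (to_real R M) = \rank (map_mx intr M : 'M[rat]_(m, n)).
Proof. by rewrite to_realE mxrank_map. Qed.

End RealImage.

Lemma rank_trivial_kernel (F : fieldType) (m n : nat) (M : 'M[F]_(m, n)) :
  (forall x : 'cV[F]_n, M *m x = 0 -> x = 0) -> \rank M = n.
Proof.
move=> ker0; rewrite -mxrank_tr; apply/eqP; apply/row_freeP.
have [x /ker0 ->|y yM] := @row_space_of_kernel _ _ _ _ M 1%:M.
  by rewrite mulmx0.
by exists y^T; rewrite -trmx_mul -yM trmx1.
Qed.

(** The rank does not change between the rationals and the reals, and a rational
    dependency between the columns can be made integral. *)
Lemma rank_trivial_int_kernel (R : realType) (m n : nat) (M : 'M[int]_(m, n)) :
  (forall z : 'cV[int]_n, M *m z = 0 -> z = 0) -> \rank (to_real R M) = n.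
Proof.
move=> ker0; rewrite rank_to_real; apply: rank_trivial_kernel => q Mq0.
have [D [z [D_gt0 zE]]] := clear_denominators q.
have z0 : z = 0.
  apply: ker0; apply: (@to_real_inj R); rewrite to_realE map_mxM zE -scalemxAr Mq0.
  by rewrite scaler0 to_realE !map_mx0.
move/eqP: zE; rewrite z0 map_mx0 eq_sym scaler_eq0 intr_eq0 gt_eqF //=.
by move/eqP.
Qed.

Section Columns.
Variables (F : comPzRingType) (n : nat) (s : {set 'I_n}).

Lemma cols_mul (p q : nat) (M : 'M[F]_(p, q)) (N : 'M[F]_(q, n)) :
  cols s (M *m N) = M *m cols s N.
Proof. by rewrite /cols mulmx_colsub. Qed.

Lemma rows_mul (p q : nat) (M : 'M[F]_(n, p)) (N : 'M[F]_(p, q)) :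
  rows s (M *m N) = rows s M *m N.
Proof. by rewrite /rows mul_rowsub_mx. Qed.

Lemma sum_set (f : 'I_n -> F) (t : {set 'I_n}) :
  \sum_(k < #|t|) f (enum_val k) = \sum_(i in t) f i.
Proof. exact/esym/big_enum_val. Qed.

Lemma mul_supported (p q : nat) (M : 'M[F]_(p, n)) (x : 'M[F]_(n, q)) :
  (forall i j, i \notin s -> x i j = 0) -> M *m x = cols s M *m rows s x.
Proof.
move=> x0; apply/matrixP => i j; rewrite !mxE.
under [RHS]eq_bigr => k _ do rewrite !mxE.
rewrite (sum_set (fun k => M i k * x k j)) [LHS](bigID (mem s)) /=.
by rewrite [X in _ + X]big1 ?addr0 // => k /x0 ->; rewrite mulr0.
Qed.

Definition zero_extend (q : nat) (x : 'M[F]_(#|s|, q)) : 'M[F]_(n, q) := cols s 1%:M *m x.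

Lemma zero_extend_out (q : nat) (x : 'M[F]_(#|s|, q)) i j : i \notin s -> zero_extend x i j = 0.
Proof.
move=> si; rewrite mxE big1 // => k _; rewrite !mxE.
by case: eqP => [e|_]; [move: si; rewrite e enum_valP | rewrite mul0r].
Qed.

Lemma mul_zero_extend (p q : nat) (M : 'M[F]_(p, n)) (x : 'M[F]_(#|s|, q)) :
  M *m zero_extend x = cols s M *m x.
Proof. by rewrite /zero_extend mulmxA -cols_mul mulmx1. Qed.

Lemma rows_zero_extend (q : nat) (x : 'M[F]_(#|s|, q)) : rows s (zero_extend x) = x.
Proof.
apply/matrixP => i j; rewrite !mxE (bigD1 i) //= !mxE eqxx mul1r big1 ?addr0 // => k ki.
by rewrite !mxE (inj_eq enum_val_inj) eq_sym (negbTE ki) mul0r.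
Qed.

End Columns.

(** * Relaxing nonnegativity constraints *)

Section Relaxation.
Variables (d n : nat) (A : 'M[int]_(d, n)) (c : 'rV[int]_n).

Lemma costD (x y : 'cV[int]_n) : (c *m (x + y)) 0 0 = (c *m x) 0 0 + (c *m y) 0 0.
Proof. by rewrite mulmxDr [LHS]mxE. Qed.

(** Optimality of u in the program without the constraints x_i >= 0, i in t, put
    in terms of the differences y = x - u. *)
Definition solved_by_relaxation (u : 'cV[int]_n) (t : {set 'I_n}) : Prop :=
  forall y : 'cV[int]_n, A *m y = 0 ->
    (forall i, i \notin t -> 0 <= u i 0 + y i 0) -> 0 <= (c *m y) 0 0.
Local Notation relax := solved_by_relaxation.

Lemma relaxS (u : 'cV[int]_n) (t t' : {set 'I_n}) :
  t \subset t' -> relax u t' -> relax u t.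
Proof.
move=> /subsetP tt' ut' y Ay0 y_ge; apply: ut' => // i it'; apply: y_ge.
by apply: contra it'; apply: tt'.
Qed.

Lemma relax_eq (u v : 'cV[int]_n) (t : {set 'I_n}) :
  (forall i, i \notin t -> u i 0 = v i 0) -> relax u t -> relax v t.
Proof.
by move=> uv ut y Ay0 y_ge; apply: ut => // i it; rewrite uv // y_ge.
Qed.

(** The elements of [translate u t], with the multiplicities as an argument. *)
Definition raise (t : {set 'I_n}) (k : 'I_n -> nat) (u : 'cV[int]_n) : 'cV[int]_n :=
  u + \sum_(i in t) delta_mx i 0 *+ k i.

Lemma raiseE (t : {set 'I_n}) k (u : 'cV[int]_n) i :
  raise t k u i 0 = u i 0 + (if i \in t then (k i)%:Z else 0).
Proof.
rewrite /raise mxE summxE; congr (_ + _).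
have dE j : (delta_mx j 0 *+ k j : 'cV[int]_n) i 0 = if j == i then (k i)%:Z else 0.
  rewrite mulmxnE mxE eqxx andbT eq_sym; case: eqP => [->|_]; rewrite ?mul0rn //.
  exact: natz.
under eq_bigr => j _ do rewrite dE.
rewrite -big_mkcondr; case: ifP => it.
  by rewrite (big_pred1 i) // => j /=; case: eqP => [->|_]; rewrite ?it ?andbF.
by rewrite big_pred0 // => j; case: eqP => [->|_]; rewrite ?it ?andbF.
Qed.

Lemma raise_nonneg (t : {set 'I_n}) k (u : 'cV[int]_n) :
  nonneg u -> nonneg (raise t k u).
Proof. by move=> u_ge0 i; rewrite raiseE addr_ge0 //; case: ifP. Qed.

Lemma relax_raise (s t : {set 'I_n}) k (u : 'cV[int]_n) :
  t \subset s -> relax (raise t k u) s <-> relax u s.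
Proof.
move=> /subsetP ts; split; apply: relax_eq => i si;
  by rewrite raiseE ifN ?addr0 //; apply: contra si; apply: ts.
Qed.

Lemma optimalP (u : 'cV[int]_n) :
  optimal_set A c u <-> nonneg u /\ relax u set0.
Proof.
split=> [[b bA [[Au u_ge0] umin]]|[u_ge0 ut]].
  split=> // y Ay0 y_ge; have := umin (u + y); rewrite costD lerDl; apply.
  by split=> [|i]; rewrite ?mulmxDr ?Ay0 ?addr0 // mxE y_ge ?inE.
exists (A *m u); first by exists u.
split=> // x [Ax x_ge0]; have := ut (x - u); rewrite mulmxBr Ax subrr => /(_ erefl).
rewrite -(lerD2l ((c *m u) 0 0)) addr0 -costD [u + _]addrC subrK; apply=> i _.
by rewrite !mxE addrCA subrr addr0.
Qed.

Lemma optimal_relax (u : 'cV[int]_n) (t : {set 'I_n}) :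
  nonneg u -> relax u t -> optimal_set A c u.
Proof. by move=> u_ge0 ut; apply/optimalP; split => //; apply: relaxS ut; apply: sub0set. Qed.

(** A competitor y that only needs u + y >= 0 outside t becomes feasible after
    u_i is raised by |y_i| for i in t. *)
Lemma translate_optimalP (u : 'cV[int]_n) (t : {set 'I_n}) :
  nonneg u -> (translate u t `<=` optimal_set A c)%classic <-> relax u t.
Proof.
move=> u_ge0; split=> [opt y Ay0 y_ge|ut _ [k ->]]; last first.
  by apply: (@optimal_relax _ t); [apply: raise_nonneg | apply/relax_raise].
have /optimalP[_] : optimal_set A c (raise t (fun i => absz (y i 0)) u).
  by apply: opt; exists (fun i => absz (y i 0)).
apply=> // i _; rewrite raiseE; case: ifP => it; last by rewrite addr0 y_ge ?it.
by rewrite -addrA addr_ge0 // -lerBlDr sub0r abszE -normrN ler_norm.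
Qed.

Hypothesis generic_c : generic A c.

Lemma IP_optimal_unique (b : 'cV[int]_d) (x x' : 'cV[int]_n) :
  IP_optimal A c b x -> IP_optimal A c b x' -> x = x'.
Proof.
move=> xopt x'opt; have bA : semigroup A b by case: xopt => -[Ax x_ge0] _; exists x.
by have [x0 [_ uniq]] := generic_c bA; rewrite -(uniq _ xopt) (uniq _ x'opt).
Qed.

(** If c.y = 0, then u and u + y, both raised on t until they are nonnegative, are
    two optimal solutions of the same program. *)
Lemma relax_strict (u : 'cV[int]_n) (t : {set 'I_n}) (y : 'cV[int]_n) :
  nonneg u -> relax u t -> A *m y = 0 -> y != 0 ->
  (forall i, i \notin t -> 0 <= u i 0 + y i 0) -> 0 < (c *m y) 0 0.
Proof.
move=> u_ge0 ut Ay0 y0 y_ge; rewrite lt_neqAle ut // andbT eq_sym.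
apply: contraNneq y0 => cy0.
pose v := raise t (fun i => absz (y i 0)) u.
have v_ge0 : nonneg v by apply: raise_nonneg.
have vy_ge0 : nonneg (v + y).
  move=> i; rewrite mxE raiseE; case: ifP => it; last by rewrite addr0 y_ge ?it.
  by rewrite -addrA addr_ge0 // -lerBlDr sub0r abszE -normrN ler_norm.
have [b bA vopt] : optimal_set A c v.
  by apply: (@optimal_relax _ t) => //; apply/relax_raise.
have vyopt : IP_optimal A c b (v + y).
  case: vopt => -[Av _] vmin; split => [|x xb].
    by split; first by rewrite mulmxDr Ay0 addr0.
  by rewrite costD cy0 addr0 vmin.
by apply/eqP/(addrI v); rewrite addr0 (IP_optimal_unique vyopt vopt).
Qed.

(** Maximality of t is only tested on the index sets with one more element; larger
    ones are covered by monotonicity (tight_proper). *)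
Definition tight_relaxation (u : 'cV[int]_n) (t : {set 'I_n}) : Prop :=
  [/\ nonneg u, relax u t & forall i, i \notin t -> ~ relax u (i |: t)].

Lemma tight_proper (u : 'cV[int]_n) (t t' : {set 'I_n}) :
  tight_relaxation u t -> t \proper t' -> ~ relax u t'.
Proof.
move=> [_ _ tightP] /properP[tt' [i it' it]] ut'.
by apply: (tightP i it); apply: relaxS ut'; rewrite subUset sub1set it'.
Qed.

Lemma exists_tight (u : 'cV[int]_n) (t : {set 'I_n}) :
  nonneg u -> relax u t -> exists2 t' : {set 'I_n}, t \subset t' & tight_relaxation u t'.
Proof.
move=> u_ge0 ut.
have [t' /maxsetP[/asboolP ut' t'max] tt'] :
    {t' | maxset (fun s => `[< relax u s >]) t' & t \subset t'}.
  by apply: maxset_exists; apply/asboolP.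
exists t' => //; split=> // i it' /asboolP /t'max /(_ (subsetUr _ _)) e.
by move: it'; rewrite -e setU11.
Qed.

Lemma tight_raise (t : {set 'I_n}) k (u : 'cV[int]_n) :
  tight_relaxation u t -> tight_relaxation (raise t k u) t.
Proof.
move=> [u_ge0 ut tightP]; split; [exact: raise_nonneg | exact/relax_raise|].
by move=> i it /(relax_raise _ _ (subsetUr _ _)); apply: tightP.
Qed.

Lemma tight_clear (t : {set 'I_n}) (u : 'cV[int]_n) : tight_relaxation u t ->
  tight_relaxation (\col_i if i \in t then 0 else u i 0) t.
Proof.
set v : 'cV[int]_n := \col_i _.
have eqv i : i \notin t -> u i 0 = v i 0 by move=> /negbTE it; rewrite mxE it.
move=> [u_ge0 ut tightP]; split.
- by move=> i; rewrite mxE; case: ifP.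
- exact: relax_eq eqv ut.
move=> i it vit; apply: (tightP i it); apply: relax_eq vit => j.
by rewrite !inE negb_or => /andP[_ /eqv].
Qed.

(** * Faces of the regular triangulation *)

Section Faces.
Variable R : realType.

Definition slack (y : 'rV[R]_d) : 'rV[R]_n := to_real R c - y *m to_real R A.

Lemma faceP (s : {set 'I_n}) :
  face R A c s <-> exists y, (forall j, j \in s -> slack y 0 j = 0) /\
                             (forall j, j \notin s -> 0 < slack y 0 j).
Proof.
have slackE y j : slack y 0 j = to_real R c 0 j - (y *m to_real R A) 0 j.
  exact: submx_entry.
split=> -[y [on off]]; exists y; split=> j /[dup] js.
- by move=> /on e; rewrite slackE e subrr.
- by move=> /off; rewrite slackE subr_gt0.
- by move=> /on /eqP; rewrite slackE subr_eq0 => /eqP.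
- by move=> /off; rewrite slackE subr_gt0.
Qed.

Lemma cost_slack (y : 'rV[R]_d) (x : 'cV[int]_n) :
  ((c *m x) 0 0)%:~R =
  (y *m to_real R (A *m x)) 0 0 + \sum_j slack y 0 j * (x j 0)%:~R.
Proof.
have -> : ((c *m x) 0 0)%:~R = (to_real R (c *m x)) 0 0 :> R by rewrite [RHS]mxE.
have -> : \sum_j slack y 0 j * (x j 0)%:~R = (slack y *m to_real R x) 0 0.
  by rewrite mxE; apply: eq_bigr => j _; congr (_ * _); rewrite mxE.
rewrite !to_real_mul /slack mulmxBl mulmxA [X in _ + X]mxE [X in _ + (_ + X)]mxE.
by rewrite addrC subrK.
Qed.

(** The cost of y in ker A is the sum of its entries weighted by the slacks. *)
Lemma face_relax (s : {set 'I_n}) : face R A c s -> relax 0 s.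
Proof.
move=> /faceP[y [on off]] x Ax0 x_ge; rewrite -(ler0z R) (cost_slack y) Ax0.
rewrite [to_real _ _]map_mx0 mulmx0 mxE add0r sumr_ge0 // => j _.
have [/on ->|js] := boolP (j \in s); first by rewrite mul0r.
by rewrite mulr_ge0 ?(ltW (off _ js)) // ler0z; have := x_ge j js; rewrite mxE add0r.
Qed.

(** A dependency z between the columns of a face has cost zero, since c agrees
    with y A on the face; but s is a relaxation of 0, so nonzero z would have
    positive cost. *)
Lemma face_int_independent (s : {set 'I_n}) (z : 'cV[int]_n) : face R A c s ->
  A *m z = 0 -> (forall i, i \notin s -> z i 0 = 0) -> z = 0.
Proof.
move=> sF Az0 zs; apply/eqP; apply: contraT => z0.
have := @relax_strict 0 s z _ (face_relax sF) Az0 z0.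
have -> : (c *m z) 0 0 = 0.
  have [y [on off]] := (faceP s).1 sF.
  apply: (@intr_inj R); rewrite (cost_slack y) Az0.
  rewrite [to_real _ _]map_mx0 mulmx0 mxE add0r big1 // => j _.
  by have [/on ->|/zs ->] := boolP (j \in s); rewrite ?mul0r ?mulr0.
rewrite ltxx; apply; first by move=> i; rewrite mxE.
by move=> i /zs ->; rewrite mxE.
Qed.

Lemma face_rank (s : {set 'I_n}) :
  face R A c s -> \rank (cols s (to_real R A)) = #|s|.
Proof.
move=> sF.
have -> : cols s (to_real R A) = to_real R (cols s A) by apply/matrixP => i j; rewrite !mxE.
apply: rank_trivial_int_kernel => z Az0.
rewrite -(rows_zero_extend z); have -> : zero_extend z = 0; last by apply/matrixP => i j; rewrite !mxE.
apply: (face_int_independent sF) => [|i si]; first by rewrite mul_zero_extend.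
exact: zero_extend_out.
Qed.

Lemma face_independent (s : {set 'I_n}) (x : 'cV[R]_n) : face R A c s ->
  to_real R A *m x = 0 -> (forall i, i \notin s -> x i 0 = 0) -> x = 0.
Proof.
move=> sF Ax0 xs.
have full : row_full (cols s (to_real R A)) by rewrite -col_leq_rank face_rank.
have xs' i j : i \notin s -> x i j = 0 by rewrite ord1; apply: xs.
have x0 : rows s x = 0.
  by rewrite -[rows s x]mul1mx -(mulVpmx full) -mulmxA -mul_supported // Ax0 mulmx0.
apply/colP => i; rewrite [RHS]mxE; have [si|] := boolP (i \in s); last exact: xs.
by move/colP: x0 => /(_ (enum_rank_in si i)); rewrite !mxE enum_rankK_in.
Qed.

Lemma zero_slack_face (y : 'rV[R]_d) :
  (forall j, 0 <= slack y 0 j) -> face R A c [set j | slack y 0 j == 0]%SET.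
Proof.
move=> y_ge; apply/faceP; exists y; split=> j; rewrite inE; first by move/eqP.
by rewrite lt_neqAle eq_sym => ->; rewrite y_ge.
Qed.

Lemma slackB (y w : 'rV[R]_d) e j :
  slack (y - e *: w) 0 j = slack y 0 j + e * (w *m to_real R A) 0 j.
Proof.
rewrite /slack mulmxBl -scalemxAl opprB addrCA addrC [LHS]mxE; congr (_ + _).
by rewrite [LHS]mxE.
Qed.

(** As the columns of s are independent, some w has w A = 1 on s \ t and w A = 0
    on t.  Moving y slightly in the direction - w frees exactly the inequalities of
    s \ t. *)
Lemma face_sub (s t : {set 'I_n}) : face R A c s -> t \subset s -> face R A c t.
Proof.
move=> /[dup] sF /faceP[y [on off]] /subsetP ts.
have full : row_full (cols s (to_real R A)) by rewrite -col_leq_rank face_rank.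
pose w := (\row_k (enum_val k \notin t)%:R : 'rV[R]_#|s|) *m pinvmx (cols s (to_real R A)).
have wE j : j \in s -> (w *m to_real R A) 0 j = (j \notin t)%:R.
  move=> js; have : w *m cols s (to_real R A) = \row_k (enum_val k \notin t)%:R.
    by rewrite /w -mulmxA mulVpmx // mulmx1.
  rewrite -cols_mul => /rowP/(_ (enum_rank_in js j)).
  by rewrite [LHS]mxE [RHS]mxE enum_rankK_in.
(* Small enough for e * |w a_j| to stay below the slack at each j outside s. *)
pose e := (1 + \sum_(j | j \notin s) `|(w *m to_real R A) 0 j| / slack y 0 j)^-1.
have e_gt0 : 0 < e.
  rewrite invr_gt0 ltr_wpDr // sumr_ge0 // => j js.
  by rewrite divr_ge0 // ltW // off.
apply/faceP; exists (y - e *: w); split=> j; rewrite slackB => jt.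
  by rewrite on ?ts // wE ?ts // jt mulr0 addr0.
have [js|js] := boolP (j \in s); first by rewrite on // wE // jt mulr1 add0r.
rewrite -ltrBlDr sub0r.
apply: (@le_lt_trans _ _ (e * `|(w *m to_real R A) 0 j|)).
  by rewrite -mulrN ler_pM2l // -normrN ler_norm.
rewrite mulrC -ltr_pdivlMr // -ltr_pdivrMl ?off // mulrC /e invrK (bigD1 j) //= addrCA.
rewrite ltrDl ltr_wpDr // sumr_ge0 // => i /andP[si _].
by rewrite divr_ge0 // ltW // off.
Qed.

(** As u >= 0, every lattice vector that is nonnegative outside t has nonnegative
    cost, and clearing denominators extends this to rational vectors.  So Farkas'
    lemma yields y with c - y A nonnegative, and zero on t; the indices where it
    vanishes form a face containing t. *)
Lemma relax_face (u : 'cV[int]_n) (t : {set 'I_n}) :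
  nonneg u -> relax u t -> face R A c t.
Proof.
move=> u_ge0 ut.
pose E := rows (~: t) (1%:M : 'M[rat]_n).
have [q Aq0 q_ge|y [l [l_ge0 cE]]] :=
    @farkas rat _ _ _ (map_mx intr A) E (map_mx intr c).
  have [D [z [D_gt0 zE]]] := clear_denominators q.
  have Az0 : A *m z = 0.
    apply: (@to_real_inj R); rewrite to_realE map_mxM zE -scalemxAr Aq0.
    by rewrite scaler0 to_realE !map_mx0.
  have D_gt0' : (0 : rat) < D%:~R by rewrite ltr0z.
  have : 0 <= (c *m z) 0 0.
    apply: ut => // i it; rewrite addr_ge0 // -(ler0z rat).
    move/matrixP: zE => /(_ i 0); rewrite !mxE => ->; rewrite pmulr_rge0 //.
    have it' : i \in ~: t by rewrite inE.
    have := q_ge (enum_rank_in it' i).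
    by rewrite /E -rows_mul mul1mx mxE enum_rankK_in.
  rewrite -(ler0z rat) -(pmulr_rge0 _ D_gt0').
  suff -> : ((c *m z) 0 0)%:~R = D%:~R * (map_mx intr c *m q) 0 0 by rewrite !pmulr_rge0.
  transitivity ((map_mx intr (c *m z) : 'M[rat]_1) 0 0); first by rewrite [RHS]mxE.
  by rewrite map_mxM zE -scalemxAr [LHS]mxE.
have slackE j : slack (map_mx ratr y) 0 j = ratr ((l *m E) 0 j).
  by rewrite /slack !to_realE cE map_mxD map_mxM addrC addKr mxE.
have lE_ge0 j : 0 <= (l *m E) 0 j.
  by rewrite mxE sumr_ge0 // => k _; rewrite mulr_ge0 // !mxE ler0n.
have := @zero_slack_face (map_mx ratr y); set s := [set j | _]%SET => sF.
apply: (@face_sub s); first by apply: sF => j; rewrite slackE ler0q.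
apply/subsetP => j jt; rewrite inE slackE mxE big1 ?rmorph0 // => k _.
rewrite !mxE; case: eqP => [e|_]; rewrite ?mulr0 //.
by have := enum_valP k; rewrite e inE jt.
Qed.

Hypothesis rankA : \rank (to_real R A) = d.

(** If w is orthogonal to the columns of s but not to all columns, then moving y
    along w or - w until the first new inequality holds with equality produces a
    larger face.  So w A = 0, and w = 0 as A has rank d. *)
Lemma maximal_face_rank (s : {set 'I_n}) :
  maximal_face R A c s -> \rank (cols s (to_real R A)) = d.
Proof.
move=> [/faceP[y [on off]] smax].
have y_ge j : 0 <= slack y 0 j.
  by have [/on ->|/off/ltW] := boolP (j \in s).
have w_ge0 (w : 'rV[R]_d) : w *m cols s (to_real R A) = 0 ->
    forall j, 0 <= (w *m to_real R A) 0 j.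
  move=> ws; set v := w *m to_real R A => j; rewrite leNgt; apply/negP => vj.
  have vs i : i \in s -> v 0 i = 0.
    move: ws; rewrite -cols_mul => /rowP ws si.
    by have := ws (enum_rank_in si i); rewrite !mxE enum_rankK_in.
  pose ratio i := slack y 0 i / - v 0 i.
  have [k vk kmin] := @arg_minP _ _ _ j (fun i => v 0 i < 0) ratio vj.
  have ks : k \notin s by apply: contraTN vk => /vs ->; rewrite ltxx.
  have e_ge0 : 0 <= ratio k by rewrite divr_ge0 // oppr_ge0 ltW.
  have zF := @zero_slack_face (y - ratio k *: w).
  move: zF; set s' := [set i | _]%SET => s'F.
  have /smax : face R A c s'.
    apply: s'F => i; rewrite slackB -/v.
    have [vi|vi] := ltP (v 0 i) 0; last by rewrite addr_ge0 // mulr_ge0.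
    rewrite -lerBlDr sub0r -mulrN -ler_pdivlMr ?oppr_gt0 //; exact: kmin.
  have -> : s \subset s'.
    by apply/subsetP => i si; rewrite inE slackB on // -/v vs // mulr0 addr0.
  move=> /(_ isT) e; move: ks; rewrite -e inE slackB -/v.
  by rewrite /ratio invrN mulrN mulNr divfK ?subrr ?eqxx // lt_eqF.
rewrite -mxrank_tr; apply: rank_trivial_kernel => x /(congr1 trmx).
rewrite trmx_mul trmxK trmx0 => xs0.
have free : row_free (to_real R A) by rewrite /row_free rankA.
suff : x^T *m to_real R A = 0.
  by move=> /eqP; rewrite (mulmx_free_eq0 _ free) => /eqP /(congr1 trmx); rewrite trmxK trmx0.
apply/rowP => j; rewrite [RHS]mxE; apply/eqP; rewrite eq_le w_ge0 // andbT.
have := w_ge0 (- x^T) _ j; rewrite !mulNmx xs0 oppr0 => /(_ erefl).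
by rewrite oppmx_entry oppr_ge0.
Qed.

Lemma maximal_faceP (s : {set 'I_n}) :
  maximal_face R A c s <-> face R A c s /\ #|s| = d.
Proof.
split=> [smax|[sF sd]].
  by split; [case: smax | rewrite -(face_rank smax.1) maximal_face_rank].
split=> // s' s'F ss'; apply/esym/eqP; rewrite eqEcard ss' sd -(face_rank s'F).
exact: rank_leq_row.
Qed.

Lemma face_sub_maximal (t : {set 'I_n}) :
  face R A c t -> exists2 s : {set 'I_n}, maximal_face R A c s & t \subset s.
Proof.
move=> tF.
have [s /maxsetP[/asboolP sF smax] ts] :
    {s | maxset (fun s => `[< face R A c s >]) s & t \subset s}.
  by apply: maxset_exists; apply/asboolP.
by exists s => //; split=> // s' /asboolP; apply: smax.
Qed.

(** The columns of s span, so a multiple of a_i is an integral combination of them. *)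
Lemma maximal_face_circuit (s : {set 'I_n}) (i : 'I_n) : maximal_face R A c s ->
  i \notin s -> exists x : 'cV[int]_n,
    [/\ A *m x = 0, 0 < x i 0 & forall j, j \notin s -> j != i -> x j 0 = 0].
Proof.
move=> smax si; set AQ := map_mx intr A : 'M[rat]_(d, n).
have free : row_free (cols s AQ).
  rewrite /row_free -[X in _ == X](maximal_face_rank smax).
  have -> : cols s (to_real R A) = to_real R (cols s A) by apply/matrixP => k j; rewrite !mxE.
  rewrite rank_to_real; apply/eqP; congr (\rank _).
  by apply/matrixP => k j; rewrite !mxE.
pose q := delta_mx i 0 - zero_extend (pinvmx (cols s AQ) *m col i AQ).
have Aq0 : AQ *m q = 0.
  by rewrite mulmxBr -colE mul_zero_extend mulmxA mulmxVp // mul1mx subrr.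
have qE j : j \notin s -> q j 0 = (j == i)%:R.
  by move=> sj; rewrite [LHS]mxE [X in _ + X]mxE zero_extend_out // subr0 mxE eqxx andbT.
have [D [z [D_gt0 zE]]] := clear_denominators q.
have zjE j : j \notin s -> (z j 0)%:~R = D%:~R * (j == i)%:R :> rat.
  by move=> /qE <-; move/matrixP: zE => /(_ j 0); rewrite mxE [RHS]mxE.
exists z; split.
- apply: (@to_real_inj R); rewrite to_realE map_mxM zE -scalemxAr Aq0.
  by rewrite scaler0 to_realE !map_mx0.
- by rewrite -(ltr0z rat) zjE // eqxx mulr1 ltr0z.
by move=> j sj ji; apply: (@intr_inj rat); rewrite zjE // (negbTE ji) mulr0.
Qed.

Lemma reduced_cost_slack (s : {set 'I_n}) (y : 'rV[R]_d) : maximal_face R A c s ->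
  (forall j, j \in s -> slack y 0 j = 0) -> reduced_cost R A c s = slack y.
Proof.
move=> smax on; rewrite /reduced_cost /slack; congr (_ - _ *m _).
have -> : cols s (to_real R c) = y *m cols s (to_real R A).
  rewrite -cols_mul; apply/rowP => k; rewrite [LHS]mxE [RHS]mxE.
  by apply/eqP; rewrite -subr_eq0 -submx_entry; apply/eqP/on/enum_valP.
by rewrite -mulmxA mulmxVp ?mulmx1 // /row_free maximal_face_rank.
Qed.

End Faces.
End Relaxation.

(** * A family of simplices *)

Lemma weighted_sum_eq0 (F : numDomainType) (k : nat) (a : 'rV[F]_k) (x : 'cV[F]_k) :
  (forall i, 0 < a 0 i) -> nonneg x -> \sum_i a 0 i * x i 0 = 0 -> x = 0.
Proof.
move=> a_gt0 x_ge0 /eqP; rewrite psumr_eq0 => [/allP sum0|j _]; last first.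
  by rewrite mulr_ge0 // ltW.
apply/colP => i; rewrite [RHS]mxE; apply/eqP.
by have := sum0 i (mem_index_enum i); rewrite mulf_eq0 gt_eqF.
Qed.

(** In the coordinates w = u - M z this is { w >= 0, a.w <= h } with h = a.u.  If
    h > 0, its vertices are 0 and the (h / a_j) e_j, and the barycentric
    coordinate of w at the latter is a_j w_j / h.  If h = 0, it is a point. *)
Lemma simplex_of_positive_relation (R : realType) (k m : nat) (M : 'M[R]_(k, m))
    (a : 'rV[R]_k) (u : 'cV[R]_k) :
  row_free M -> row_full M -> (forall i, 0 < a 0 i) -> nonneg u ->
  simplex ([set z | (forall i, (M *m z) i 0 <= u i 0) /\ 0 <= (a *m (M *m z)) 0 0])%classic.
Proof.
move=> Mfree Mfull a_gt0 u_ge0.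
pose L := pinvmx M.
have ML : M *m L = 1%:M by apply: mulmxVp.
have LM : L *m M = 1%:M by apply: mulVpmx.
have aE (x : 'cV[R]_k) : (a *m x) 0 0 = \sum_i a 0 i * x i 0 by rewrite mxE.
pose h := (a *m u) 0 0.
have h_ge0 : 0 <= h by rewrite /h aE sumr_ge0 // => i _; rewrite mulr_ge0 // ltW.
have hE z : (a *m (u - M *m z)) 0 0 = h - (a *m (M *m z)) 0 0.
  by rewrite mulmxBr submx_entry.
have [h0|h_neq0] := eqVneq h 0.
  exists 0, (fun=> 0); split.
    by move=> w; rewrite big_ord1 => w0 _ i; rewrite ord1.
  apply/seteqP; split=> z.
    move=> [Mz az]; exists (fun=> 1); split=> //; rewrite ?big_ord1 ?scaler0 //.
    have u0 : u = 0 by apply: (weighted_sum_eq0 a_gt0) => //; rewrite -aE.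
    have w0 : u - M *m z = 0.
      have w_ge : nonneg (u - M *m z) by move=> i; rewrite submx_entry subr_ge0.
      apply: (weighted_sum_eq0 a_gt0) => //; apply/eqP; rewrite eq_le.
      rewrite sumr_ge0 => [|i _]; last by rewrite mulr_ge0 // ltW.
      by rewrite -aE hE h0 sub0r oppr_le0 az.
    move/eqP: w0; rewrite u0 sub0r oppr_eq0 => /eqP Mz0.
    by rewrite -[z]mul1mx -LM -mulmxA Mz0 mulmx0.
  move=> [w [_ _ ->]]; rewrite big_ord1 scaler0; split=> [i|].
    by rewrite mulmx0 mxE.
  by rewrite !mulmx0 mxE.
have h_gt0 : 0 < h by rewrite lt_def h_neq0.
pose vertex (i : 'I_k.+1) : 'cV[R]_m :=
  if unlift ord0 i is Some j then L *m (u - (h / a 0 j) *: delta_mx j 0) else L *m u.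
have combE (w : 'I_k.+1 -> R) : \sum_i w i *: vertex i =
    L *m ((\sum_i w i) *: u - \col_j (w (lift ord0 j) * (h / a 0 j))).
  rewrite big_ord_recl [in RHS]big_ord_recl /vertex unlift_none.
  under eq_bigr => j _ do rewrite liftK scalemxAr.
  rewrite scalemxAr -mulmx_sumr -mulmxDr; congr (_ *m _).
  rewrite scalerDl -addrA; congr (_ + _).
  under eq_bigr => j _ do rewrite scalerBr scalerA.
  rewrite sumrB -scaler_suml; congr (_ - _).
  rewrite [RHS](_ : _ = \sum_j (\col_i (w (lift ord0 i) * (h / a 0 i))) j 0 *: delta_mx j 0).
    by apply: eq_bigr => j _; rewrite mxE.
  by rewrite {1}[LHS]matrix_sum_delta; apply: eq_bigr => j _; rewrite big_ord1.
exists k, vertex; split.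
  move=> w w0; rewrite combE w0 scale0r sub0r => /(congr1 (mulmx M)).
  rewrite mulmxA ML mul1mx mulmx0 => /colP e.
  have wj j : w (lift ord0 j) = 0.
    have := e j; rewrite !mxE => /eqP; rewrite oppr_eq0 mulf_eq0 => /orP[/eqP //|].
    by rewrite gt_eqF // divr_gt0.
  move=> i; case: (unliftP ord0 i) => [j ->//|->].
  by move: w0; rewrite big_ord_recl big1 ?addr0 // => j _; rewrite wj.
apply/seteqP; split=> z.
  move=> [Mz az].
  have w_ge i : 0 <= (u - M *m z) i 0.
    by rewrite submx_entry subr_ge0.
  pose l j := (u - M *m z) j 0 * a 0 j / h.
  have suml : \sum_j l j = (h - (a *m (M *m z)) 0 0) / h.
    by rewrite -mulr_suml -hE aE; congr (_ / _); apply: eq_bigr => j _; rewrite mulrC.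
  pose w (i : 'I_k.+1) := if unlift ord0 i is Some j then l j else 1 - \sum_j l j.
  have wS j : w (lift ord0 j) = l j by rewrite /w liftK.
  have w1 : \sum_i w i = 1.
    rewrite big_ord_recl (eq_bigr l) => [|j _]; last exact: wS.
    by rewrite /w unlift_none subrK.
  exists w; split=> //.
    move=> i; rewrite /w; case: unliftP => [j _|_].
      by rewrite /l divr_ge0 // mulr_ge0 // ltW.
    by rewrite suml subr_ge0 ler_pdivrMr // mul1r gerBl.
  rewrite combE w1 scale1r.
  rewrite [X in L *m (u - X)](_ : _ = u - M *m z); last first.
    apply/colP => j; rewrite [LHS]mxE wS /l.
    by rewrite mulrA divfK // mulfK // gt_eqF.
  by rewrite opprB addrC subrK mulmxA LM mul1mx.
move=> [w [w_ge0 w1 ->]]; rewrite combE w1 scale1r.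
set x := \col_j _.
have Mz : M *m (L *m (u - x)) = u - x by rewrite mulmxA ML mul1mx.
have xE j : x j 0 = w (lift ord0 j) * (h / a 0 j) by rewrite mxE.
split=> [i|]; rewrite Mz.
  by rewrite submx_entry gerBl xE mulr_ge0 // divr_ge0 // ltW.
have -> : (a *m (u - x)) 0 0 = h - (a *m x) 0 0.
  by rewrite mulmxBr submx_entry.
have -> : (a *m x) 0 0 = (\sum_j w (lift ord0 j)) * h.
  rewrite aE mulr_suml; apply: eq_bigr => j _.
  by rewrite xE mulrCA; congr (_ * _); rewrite mulrC divfK // gt_eqF.
rewrite -{1}[h]mul1r -mulrBl mulr_ge0 // -w1 big_ord_recl addrK; exact: w_ge0.
Qed.

(** * Gomory families, associated sets and standard pairs *)

Section Characterizations.
Variables (R : realType) (d n : nat) (A : 'M[int]_(d, n)) (c : 'rV[int]_n).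
Hypothesis rankA : \rank (to_real R A) = d.
Hypothesis generic_c : generic A c.
Local Notation relax := (solved_by_relaxation A c).
Local Notation tight := (tight_relaxation A c).

(** A relaxation of 0 is a face, so none can properly contain s. *)
Lemma maximal_face_tight (s : {set 'I_n}) : maximal_face R A c s -> tight 0 s.
Proof.
move=> [sF smax]; split; [by move=> i; rewrite mxE | exact: face_relax sF|].
move=> i si is0; have isF : face R A c (i |: s).
  by apply: relax_face is0 => // j; rewrite mxE.
by move: si; rewrite -(smax _ isF) ?subsetUr // setU11.
Qed.

(** The cost of the group relaxation is c.x - y A x, and y A x is constant on each
    fibre of A. *)
Lemma ler_group_cost (s t : {set 'I_n}) (x x' : 'cV[int]_n) :
  maximal_face R A c s -> t \subset s -> A *m x = A *m x' ->
  (\sum_(i | i \notin t) reduced_cost R A c s 0 i * (x i 0)%:~R <=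
   \sum_(i | i \notin t) reduced_cost R A c s 0 i * (x' i 0)%:~R) =
  ((c *m x) 0 0 <= (c *m x') 0 0).
Proof.
move=> smax ts Axx'.
have [y [on _]] := (faceP A c R s).1 smax.1.
have sumE (z : 'cV[int]_n) :
    \sum_(i | i \notin t) reduced_cost R A c s 0 i * (z i 0)%:~R =
    \sum_i slack A c y 0 i * (z i 0)%:~R.
  rewrite (reduced_cost_slack rankA smax on) [RHS](bigID (mem t)) /= [X in X + _]big1 ?add0r //.
  by move=> i /(subsetP ts) /on ->; rewrite mul0r.
by rewrite !sumE -(ler_int R) !(cost_slack A c y) Axx' lerD2l.
Qed.

Lemma group_solvesP (u : 'cV[int]_n) (t : {set 'I_n}) : optimal_set A c u ->
  group_solves R A c t (A *m u) <-> face R A c t /\ relax u t.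
Proof.
move=> uopt; split=> [[s [smax ts [x [[Ax xt] xmin] x_ge0]]]|[tF ut]].
  split; first exact: (face_sub generic_c smax.1 ts).
  have xP x' : A *m x' = A *m u -> (forall i, i \notin t -> 0 <= x' i 0) ->
      (c *m x) 0 0 <= (c *m x') 0 0.
    move=> Ax' x'_ge; rewrite -(ler_group_cost smax ts) ?Ax ?Ax' //.
    by apply: xmin; split.
  have [b _ ub] := uopt; have Au : A *m u = b by case: ub => -[].
  have xb : IP_optimal A c b x.
    by split; [split; rewrite -?Au | move=> x' [Ax' x'_ge]; apply: xP; rewrite ?Au].
  move=> y Ay0 y_ge; have := xP (u + y); rewrite (IP_optimal_unique generic_c xb ub).
  rewrite costD lerDl; apply; first by rewrite mulmxDr Ay0 addr0.
  by move=> i it; rewrite mxE y_ge.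
have [u_ge0 _] := (optimalP A c u).1 uopt.
have [s smax ts] := face_sub_maximal tF.
exists s; split=> //; exists u => //; split=> [|x [Ax x_ge]]; first by split.
rewrite (ler_group_cost smax ts) ?Ax //.
have := ut (x - u); rewrite mulmxBr Ax subrr => /(_ erefl).
rewrite -(lerD2l ((c *m u) 0 0)) addr0 -costD [u + _]addrC subrK; apply=> i it.
by rewrite !mxE addrCA subrr addr0 x_ge.
Qed.

(** If t is tight for u, then so is it for u raised by N on t.  For N large, a
    maximal face s that solves the program of the raised vector contains t: for i
    in t \ s, the circuit x through i has positive cost, while - x would be
    an admissible change, because only its entry at i is negative outside s. *)
Lemma gomory_familyP :
  gomory_family R A c <-> forall u t, tight u t -> maximal_face R A c t.
Proof.
split=> [gomory u t ut|tight_max b bA].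
  have circuit (p : {set 'I_n} * 'I_n) : exists x : 'cV[int]_n,
      maximal_face R A c p.1 -> p.2 \notin p.1 ->
      [/\ A *m x = 0, 0 < x p.2 0 & forall j, j \notin p.1 -> j != p.2 -> x j 0 = 0].
    have [[pmax p12]|np] := pselect (maximal_face R A c p.1 /\ p.2 \notin p.1).
      by have [x xP] := maximal_face_circuit rankA pmax p12; exists x.
    by exists 0 => pmax p12; case: np.
  have {circuit} [X XP] := choice circuit.
  (* N bounds the entry at i of the chosen circuit of every pair (s, i). *)
  pose f p := absz (X p p.2 0); pose N := (\sum_p f p)%N.
  have NP s i : X (s, i) i 0 <= N%:Z.
    apply: (@le_trans _ _ (f (s, i))%:Z); first by rewrite abszE ler_norm.
    by rewrite lez_nat /N (bigD1 (s, i)) //= leq_addr.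
  pose v := raise t (fun=> N) u.
  have [v_ge0 vt vtight] : tight v t := tight_raise _ ut.
  have vopt : optimal_set A c v := optimal_relax v_ge0 vt.
  have [s smax] := gomory (A *m v) (ex_intro2 _ _ v v_ge0 erefl).
  move=> /(group_solvesP _ vopt)[sF vs].
  have ts : t \subset s.
    apply/subsetP => i it; apply: contraT => si.
    have [/= Ax0 xi_gt0 x0] := XP (s, i) smax si.
    set x := X (s, i) in Ax0 xi_gt0 x0.
    have : 0 < (c *m x) 0 0.
      apply: (relax_strict generic_c _ (face_relax sF) Ax0).
      - by move=> j; rewrite mxE.
      - by apply: contraTneq xi_gt0 => ->; rewrite mxE ltxx.
      - move=> j sj; rewrite mxE add0r; have [->|ji] := eqVneq j i; first exact: ltW.
        by rewrite x0.
    have := vs (- x); rewrite mulmxN Ax0 oppr0 => /(_ erefl).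
    have -> : (c *m - x) 0 0 = - (c *m x) 0 0 by rewrite mulmxN oppmx_entry.
    rewrite oppr_ge0 leNgt => H cx_gt0; move: H; rewrite cx_gt0; apply=> j sj.
    rewrite oppmx_entry; have [->|ji] := eqVneq j i.
      rewrite subr_ge0 raiseE it; apply: (le_trans (NP s i)).
      by rewrite lerDr; case: ut.
    by rewrite x0 // subr0.
  have [/eqP -> //|] := boolP (t == s).
  move=> nts; have tps : t \proper s by rewrite properEneq nts.
  have us : relax u s by apply/(relax_raise _ _ (fun=> N) u ts).
  by have := tight_proper ut tps us.
have [u [[[Au u_ge0] umin] _]] := generic_c bA.
have uopt : optimal_set A c u by exists b => //; split.
have [_ u0] := (optimalP A c u).1 uopt.
have [t _ /[dup] ut [_ utr _]] := exists_tight u_ge0 u0.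
have tmax := tight_max _ _ ut.
exists t => //; rewrite -Au; apply/group_solvesP => //; split=> //; exact: tmax.1.
Qed.

Lemma associated_setP (t : {set 'I_n}) :
  associated_set R A c t <-> exists u, tight u t.
Proof.
split=> [[tF [b [bA bt bt']]]|[u ut]].
  have [u [ub _]] := generic_c bA; have [[Au u_ge0] _] := ub.
  have uopt : optimal_set A c u by exists b.
  exists u; split=> //.
    by apply: (proj2 ((group_solvesP t uopt).1 _)); rewrite Au.
  move=> i it uit; apply: (bt' (i |: t)); rewrite ?properUr ?sub1set //.
    exact: relax_face uit.
  by rewrite -Au; apply/group_solvesP => //; split=> //; exact: relax_face uit.
have [u_ge0 utr _] := ut; have uopt := optimal_relax u_ge0 utr.
have tF : face R A c t by apply: relax_face utr.
split=> //; exists (A *m u); split; first by exists u.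
  by apply/group_solvesP.
by move=> t' _ tt' /(group_solvesP _ uopt)[_]; apply: tight_proper tt'.
Qed.

(** S(u, t) is contained in S(v, t') iff t is contained in t' and v agrees with u
    outside t'.  So a pair that covers (u, t) properly amounts to a relaxation of u
    that contains t properly. *)
Lemma standard_pairP (t : {set 'I_n}) :
  (exists u, standard_pair R A c u t) <-> exists u, tight u t.
Proof.
split=> [[u [[tF uopt suppu ut] umax]]|[u0 /tight_clear]].
  have [u_ge0 _] := (optimalP A c u).1 uopt.
  have u0 i : i \in t -> u i 0 = 0.
    move=> it; apply/eqP; apply: contraT => ui.
    by have := subsetP suppu i; rewrite !inE ui it => /(_ isT).
  exists u; split=> //; first exact/translate_optimalP.
  move=> i it uit; set t' := i |: t in uit.
  pose v : 'cV[int]_n := \col_j if j \in t' then 0 else u j 0.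
  have v_ge0 : nonneg v by move=> j; rewrite mxE; case: ifP.
  have vt' : relax v t'.
    by apply: relax_eq uit => j /negbTE jt'; rewrite mxE jt'.
  (* v is u with the coordinates in t' cleared, so that S(v, t') covers S(u, t). *)
  apply: (umax v t').
    split; [exact: relax_face uit | exact: optimal_relax vt' | | exact/translate_optimalP].
    by apply/subsetP => j; rewrite [in X in X -> _]inE mxE in_setC; case: (j \in t'); rewrite ?eqxx.
  split=> [x [k xE]|].
    have x_ge0 : nonneg x by rewrite xE; exact: (raise_nonneg t k u_ge0).
    exists (fun j => absz (x j 0)); apply/colP => j.
    rewrite [RHS]raiseE mxE; case: ifP => jt'; first by rewrite add0r abszE ger0_norm.
    rewrite addr0 xE [LHS]raiseE ifF ?addr0 //.
    by apply: contraFF jt' => jt; rewrite inE jt orbT.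
  move=> /(_ (raise t' (fun=> (absz (u i 0)).+1) v)) [|k /colP /(_ i)].
    by exists (fun=> (absz (u i 0)).+1).
  rewrite [LHS]raiseE [RHS]raiseE (negbTE it) mxE setU11 add0r addr0 => e.
  by have := ler_norm (u i 0); rewrite -abszE -{1}e lez_nat ltnn.
set u : 'cV[int]_n := \col_i _ => ut; have [u_ge0 utr _] := ut.
have u0E i : i \in t -> u i 0 = 0 by move=> it; rewrite mxE it.
exists u; split.
  split; [exact: relax_face utr | exact: optimal_relax utr | | exact/translate_optimalP].
  by apply/subsetP => i; rewrite inE in_setC; apply: contra => /u0E ->.
move=> w t' [t'F wopt suppw wt'] [sub nsub].
have [w_ge0 _] := (optimalP A c w).1 wopt.
have {wt'} wt' : relax w t' by apply/translate_optimalP.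
(* Outside t', all elements of S(u, t) agree with w. *)
have raise_u k i : i \notin t' -> raise t k u i 0 = w i 0.
  move=> it'; have [|k' ->] := sub (raise t k u); first by exists k.
  by rewrite [LHS]raiseE (negbTE it') addr0.
have tt' : t \subset t'.
  apply/subsetP => i it; apply: contraT => it'.
  have := raise_u (fun=> 1%N) i it'; rewrite -(raise_u (fun=> 0%N) i it').
  by rewrite !raiseE it => /addrI.
have uw i : i \notin t' -> w i 0 = u i 0.
  move=> it'; rewrite -(raise_u (fun=> 0%N) i it') raiseE ifN ?addr0 //.
  by apply: contra it'; apply: subsetP.
have ut' : relax u t' by apply: relax_eq wt'.
have [e|ntt'] := eqVneq t t'; last first.
  by apply: (tight_proper ut) ut'; rewrite properEneq ntt'.
apply: nsub; rewrite -e; suff -> : w = u by [].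
apply/colP => i; have [it|it] := boolP (i \in t); last by apply: uw; rewrite -e.
rewrite u0E //; apply/eqP; apply: contraT => wi.
by have := subsetP suppw i; rewrite !inE wi -e it => /(_ isT).
Qed.

End Characterizations.

(** * Standard polytopes *)

Section StandardPolytopes.
Variables (R : realType) (d n : nat) (A : 'M[int]_(d, n)) (c : 'rV[int]_n).
Variable (B : 'M[int]_(n, n - d)).
Hypothesis rankA : \rank (to_real R A) = d.
Hypothesis generic_c : generic A c.
Hypothesis basisB : lattice_basis A B.
Local Notation relax := (solved_by_relaxation A c).
Local Notation tight := (tight_relaxation A c).

(** Over the rationals, the n - d columns of B span the kernel of A, whose dimension
    is n - d; so they are independent. *)
Lemma lattice_basis_row_full : row_full (to_real R B).
Proof.
rewrite -col_leq_rank rank_to_real; set BQ := map_mx intr B.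
set AQ := map_mx intr A : 'M[rat]_(d, n).
have rankAQ : \rank AQ = d by rewrite -[RHS]rankA rank_to_real.
rewrite -[X in (X <= _)%N](_ : \rank (cokermx AQ) = _); last first.
  by rewrite mxrank_coker rankAQ.
rewrite -mxrank_tr -[X in (_ <= X)%N]mxrank_tr mxrankS //.
apply/row_subP => j; rewrite -tr_col.
have [D [z [D_gt0 zE]]] := clear_denominators (col j (cokermx AQ)).
have [w wE] : exists w, z = B *m w.
  apply/basisB; apply: (@to_real_inj R); rewrite to_realE map_mxM zE -scalemxAr.
  by rewrite colE mulmxA mulmx_coker mul0mx scaler0 to_realE !map_mx0.
have D0 : D%:~R != 0 :> rat by rewrite intr_eq0 gt_eqF.
apply/submxP; exists (D%:~R^-1 *: (map_mx intr w)^T).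
rewrite -scalemxAl -trmx_mul -map_mxM -wE zE linearZ /= scalerA mulVf //.
by rewrite scale1r.
Qed.

Lemma basis_kernel (z : 'cV[int]_(n - d)) : A *m (B *m z) = 0.
Proof. by apply/basisB; exists z. Qed.

Lemma real_basis_kernel (z : 'cV[R]_(n - d)) : to_real R A *m (to_real R B *m z) = 0.
Proof.
rewrite mulmxA -to_real_mul (_ : A *m B = 0) ?[to_real _ _]map_mx0 ?mul0mx //.
apply/matrixP => i j; have /colP/(_ i) := basis_kernel (delta_mx j 0).
by rewrite mulmxA -colE !mxE.
Qed.

Lemma basis_inj (z : 'cV[int]_(n - d)) : B *m z = 0 -> z = 0.
Proof.
move=> /(congr1 (@to_real R _ _)); rewrite to_real_mul => Bz; apply: (@to_real_inj R).
rewrite -[LHS]mul1mx -(mulVpmx lattice_basis_row_full) -mulmxA Bz.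
by rewrite /to_real !map_mx0 mulmx0.
Qed.

(** The inequalities in terms of the vector B z, without the block structure. *)
Lemma QP (u : 'cV[int]_n) (p : {set 'I_n}) (z : 'cV[R]_(n - d)) :
  Q R B c u p z <->
  (forall i, i \in p -> (to_real R B *m z) i 0 <= (u i 0)%:~R) /\
  0 <= (to_real R c *m (to_real R B *m z)) 0 0.
Proof.
have lhsE : Q_lhs R B c p *m z =
    col_mx (rows p (to_real R B *m z)) (- (to_real R c *m (to_real R B *m z))).
  rewrite /Q_lhs /to_real map_col_mx mul_col_mx; congr col_mx.
    by rewrite rows_mul; congr (_ *m _); apply/matrixP => i j; rewrite !mxE.
  by rewrite map_mxN map_mxM mulNmx mulmxA.
rewrite /Q /hpolyhedron /= lhsE /Q_rhs /to_real map_col_mx; split=> [H|[Bz cz] i].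
  split=> [i ip|].
    have := H (lshift 1 (enum_rank_in ip i)); rewrite !col_mxEu.
    by rewrite [X in X <= _ -> _]mxE [X in _ <= X -> _]mxE [X in _ <= X%:~R -> _]mxE enum_rankK_in.
  have := H (rshift #|p| 0); rewrite !col_mxEd.
  by rewrite [X in X <= _ -> _]mxE [X in _ <= X -> _]mxE [X in _ <= X%:~R -> _]mxE oppr_le0.
rewrite -(splitK i); case: (split i) => j /=; rewrite ?col_mxEu ?col_mxEd.
  by rewrite [X in X <= _]mxE [X in _ <= X]mxE [X in _ <= X%:~R]mxE Bz // enum_valP.
by rewrite ord1 [X in X <= _]mxE [X in _ <= X]mxE [X in _ <= X%:~R]mxE oppr_le0.
Qed.

Lemma lattice_pointP (u : 'cV[int]_n) (p : {set 'I_n}) (z : 'cV[int]_(n - d)) :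
  lattice_points (Q R B c u p) z <->
  (forall i, i \in p -> (B *m z) i 0 <= u i 0) /\ 0 <= (c *m (B *m z)) 0 0.
Proof.
rewrite /lattice_points /=; split=> [/QP|H].
  rewrite -!to_real_mul => -[Bz cz]; split=> [i /Bz|].
    by rewrite [X in X <= _ -> _]mxE ler_int.
  by move: cz; rewrite [X in _ <= X -> _]mxE ler0z.
apply/QP; rewrite -!to_real_mul; case: H => Bz cz; split=> [i /Bz|].
  by rewrite [X in _ -> is_true (X <= _)]mxE ler_int.
by rewrite [X in _ <= X]mxE ler0z.
Qed.

Lemma nonzero_lattice_pointP (u : 'cV[int]_n) (t : {set 'I_n}) : nonneg u ->
  (exists2 z, z != 0 & lattice_points (Q R B c u (~: t)) z) <-> ~ relax u t.
Proof.
move=> u_ge0; split=> [[z z0 /lattice_pointP[Bz cz]] ut|].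
  have : 0 < (c *m (- (B *m z))) 0 0.
    apply: (relax_strict generic_c u_ge0 ut).
    - by rewrite mulmxN basis_kernel oppr0.
    - by rewrite oppr_eq0; apply: contraNneq z0 => /basis_inj ->.
    by move=> i it; rewrite oppmx_entry subr_ge0 Bz // inE.
  have -> : (c *m - (B *m z)) 0 0 = - (c *m (B *m z)) 0 0 by rewrite mulmxN oppmx_entry.
  by rewrite oppr_gt0 ltNge cz.
move=> /existsNP[y /not_implyP[Ay0 /not_implyP[y_ge /negP]]]; rewrite -ltNge => cy.
have [z zE] : exists z, - y = B *m z by apply/basisB; rewrite mulmxN Ay0 oppr0.
have cyE : (c *m - y) 0 0 = - (c *m y) 0 0 by rewrite mulmxN oppmx_entry.
exists z.
  apply: contraTneq cy => z0; rewrite -[y]opprK zE z0 mulmx0 oppr0 mulmx0 mxE.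
  by rewrite ltxx.
apply/lattice_pointP; rewrite -zE cyE oppr_ge0 ltW //; split=> // i.
by rewrite inE => /y_ge; rewrite oppmx_entry -lerBlDr sub0r.
Qed.

(** Removing the inequality indexed by i from the polytope of t gives that of i |: t. *)
Lemma standard_polytopeP (u : 'cV[int]_n) (t : {set 'I_n}) :
  standard_polytope R A c B u t <-> tight u t.
Proof.
have setE i : ~: t :\ i = ~: (i |: t) by rewrite setCU setIC -setDE.
split=> [[tF u_ge0 Qt Qti]|[u_ge0 ut tightP]].
  split=> // [|i it].
    have [//|] := pselect (relax u t); move=> /(nonzero_lattice_pointP _ u_ge0)[z z0].
    by rewrite Qt => /= e; rewrite e eqxx in z0.
  by apply/(nonzero_lattice_pointP _ u_ge0); rewrite -setE; apply: Qti; rewrite inE.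
split=> //; first exact: relax_face ut.
  apply/seteqP; split=> [z zQ|_ ->] /=.
    apply/eqP; apply: contraT => z0.
    by case: ((nonzero_lattice_pointP t u_ge0).1 _ ut); exists z.
  apply/lattice_pointP; rewrite !mulmx0; split=> [i _|]; last by rewrite mxE.
  by rewrite mxE; apply: u_ge0.
by move=> i; rewrite setE inE => it; apply/(nonzero_lattice_pointP _ u_ge0)/tightP.
Qed.

(** The count #|~: t| + 1 = n - d + 1 of the inequalities gives #|t| = d. *)
Lemma hsimplex_facets (u : 'cV[int]_n) (t : {set 'I_n}) : face R A c t ->
  hsimplex (Q_lhs R B c (~: t)) (Q_rhs R u (~: t)) -> maximal_face R A c t.
Proof.
move=> tF [_]; rewrite addn1 => -[e]; apply/maximal_faceP => //; split=> //.
have := cardsC t; rewrite e card_ord => e'.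
have dn : (d <= n)%N by rewrite -rankA rank_leq_col.
by apply/eqP; rewrite -(eqn_add2r (n - d)) e' subnKC.
Qed.

(** On the image of B, the cost c is the combination of the coordinates outside t
    weighted by the slacks of t, which are positive. *)
Lemma maximal_face_hsimplex (u : 'cV[int]_n) (t : {set 'I_n}) :
  nonneg u -> maximal_face R A c t ->
  hsimplex (Q_lhs R B c (~: t)) (Q_rhs R u (~: t)).
Proof.
move=> u_ge0 tmax; have [tF td] := (maximal_faceP generic_c rankA t).1 tmax.
have pd : #|~: t| = (n - d)%N by rewrite cardsCs setCK card_ord td.
split; last by rewrite pd addn1.
have [y [on off]] := (faceP A c R t).1 tF.
pose M := rows (~: t) (to_real R B).
have rankM : \rank M = (n - d)%N.
  apply: rank_trivial_kernel => z; rewrite /M -rows_mul => Mz0.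
  have Bz0 : to_real R B *m z = 0.
    apply: (face_independent generic_c tF); first exact: real_basis_kernel.
    move=> i it; have it' : i \in ~: t by rewrite inE.
    by have /colP/(_ (enum_rank_in it' i)) := Mz0; rewrite [LHS]mxE [RHS]mxE enum_rankK_in.
  by rewrite -[z]mul1mx -(mulVpmx lattice_basis_row_full) -mulmxA Bz0 mulmx0.
have := @simplex_of_positive_relation R _ _ M (cols (~: t) (slack A c y))
  (rows (~: t) (to_real R u)).
have -> : row_free M by rewrite /row_free rankM pd.
have -> : row_full M by rewrite /row_full rankM.
move=> /(_ isT isT) H.
suff -> : hpolyhedron (Q_lhs R B c (~: t)) (Q_rhs R u (~: t)) = [set z |
    (forall i, (M *m z) i 0 <= (rows (~: t) (to_real R u)) i 0) /\
    0 <= (cols (~: t) (slack A c y) *m (M *m z)) 0 0]%classic.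
  apply: H => k; first by rewrite mxE off //; have := enum_valP k; rewrite inE.
  by rewrite !mxE ler0z.
have costE (z : 'cV[R]_(n - d)) : to_real R c *m (to_real R B *m z) =
    cols (~: t) (slack A c y) *m (M *m z).
  rewrite /M -rows_mul -[to_real R c](subrK (y *m to_real R A)) -/(slack A c y).
  rewrite mulmxDl -[y *m _ *m _]mulmxA real_basis_kernel mulmx0 addr0.
  set x := to_real R B *m z.
  have -> : slack A c y *m x = (slack A c y) *m zero_extend (rows (~: t) x).
    apply/matrixP => i j; rewrite !ord1 [LHS]mxE [RHS]mxE; apply: eq_bigr => k _.
    have [/on ->|kt] := boolP (k \in t); first by rewrite !mul0r.
    have kt' : k \in ~: t by rewrite inE.
    have /matrixP/(_ (enum_rank_in kt' k) 0) := rows_zero_extend (rows (~: t) x).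
    by rewrite [LHS]mxE [RHS]mxE enum_rankK_in // => ->.
  by rewrite mul_zero_extend.
apply/seteqP; split=> z.
  move=> /QP[Bz cz]; split; last by rewrite -costE.
  by move=> k; rewrite /M -rows_mul [X in X <= _]mxE [X in _ <= X]mxE [X in _ <= X]mxE Bz // enum_valP.
move=> [Mz az]; apply/QP; split; last by rewrite costE.
move=> i it; have := Mz (enum_rank_in it i).
by rewrite /M -rows_mul [X in X <= _ -> _]mxE [X in _ <= X -> _]mxE [X in _ <= X -> _]mxE enum_rankK_in.
Qed.

End StandardPolytopes.

(** * The equivalence *)

Theorem theorem6p2 (R : realType) (d n : nat)
    (A : 'M[int]_(d, n)) (c : 'rV[int]_n) (B : 'M[int]_(n, n - d))
    (rankA : \rank (to_real R A) = d)
    (pointedA : pointed (cone R A))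
    (kerA : forall u : 'cV[R]_n, to_real R A *m u = 0 -> nonneg u -> u = 0)
    (generic_c : generic A c)
    (basisB : lattice_basis A B) :
  [<-> gomory_family R A c;
       forall t : {set 'I_n}, associated_set R A c t <-> maximal_face R A c t;
       forall t : {set 'I_n},
         (exists u, standard_pair R A c u t) <-> maximal_face R A c t;
       forall (u : 'cV[int]_n) (t : {set 'I_n}),
         standard_polytope R A c B u t ->
         hsimplex (Q_lhs R B c (~: t)) (Q_rhs R u (~: t))].
Proof.
have max_tight t : maximal_face R A c t -> exists u, tight_relaxation A c u t.
  by move=> /(maximal_face_tight generic_c); exists 0.
tfae.
- move=> /(gomory_familyP rankA generic_c) gomory t; split=> [|/max_tight].
    by move=> /(associated_setP rankA generic_c)[u /gomory].
  by move=> ?; apply/associated_setP.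
- move=> assoc t; split=> [|/assoc]; last first.
    by move=> /(associated_setP rankA generic_c) ?; apply/standard_pairP.
  by move=> /standard_pairP H; apply/assoc/associated_setP => //; apply: H.
- move=> std u t /(standard_polytopeP rankA generic_c basisB) ut.
  apply: (maximal_face_hsimplex rankA generic_c basisB); first by case: ut.
  by apply/std/standard_pairP => //; exists u.
move=> simp; apply/gomory_familyP => // u t ut; have [u_ge0 utr _] := ut.
apply: (@hsimplex_facets R d n A c B rankA generic_c u); first exact: relax_face utr.
by apply/simp/standard_polytopeP.
Qed.
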